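(* If $\kappa$ is a measurable cardinal, then there is a topological space $X$ with $|X|=\Delta(X)=\kappa$ which is not monotonically $\omega_1$-resolvable.
   Context: $\Delta(X)=\min\{|G|: G\ne\emptyset \text{ open in } X\}$. A topological space $X$ is monotonically $\omega_1$-resolvable if there is a function $f:X\to\omega_1$ such that $\{x\in X: f(x)\ge\alpha\}$ is dense in $X$ for each $\alpha<\omega_1$. *)

(* Defs.v *)
From mathcomp Require Import all_boot.
From mathcomp Require Import boolp classical_sets functions cardinality filter.
From mathcomp Require wochoice.
From mathcomp Require Import topology_structure.

Set Implicit Arguments.
Unset Strict Implicit.
Unset Printing Implicit Defensive.

Local Open Scope classical_set_scope.
Local Open Scope card_scope.

(* A cardinal is represented by a type of that cardinality (or by a set in a
   type), and cardinals are compared through [#<=] and [#=]. *)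

Definition card_lt T U (A : set T) (B : set U) : Prop :=
  A #<= B /\ ~ (B #<= A).

Definition card_complete K (U : set_system K) : Prop :=
  forall F : set (set K),
    card_lt F [set: K] -> F `<=` U -> U (\bigcap_(A in F) A).

(* Uncountability is part of the definition: omega carries nonprincipal
   ultrafilters, all of which are omega-complete. *)
Definition measurable_cardinal (K : Type) : Prop :=
  ~ countable [set: K] /\
  exists U : set_system K,
    [/\ UltraFilter U, forall x : K, U <> principal_filter x
      & card_complete U].

(* Well-order the uncountable type [set nat]; the points with only countably
   many predecessors form an uncountable initial segment all of whose proper
   initial segments are countable, that is, a copy of the ordinal omega_1
   (these properties are the three lemmas below and determine the order
   type). *)
Definition set_nat_le : rel (set nat) :=
  sval (wochoice.well_ordering_principle (set nat)).

Definition omega1 : Type :=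
  {x : set nat | countable [set y | set_nat_le y x]}.

Definition omega1_le (a b : omega1) : Prop := set_nat_le (sval a) (sval b).

Lemma omega1_le_well_order (A : set omega1) : A !=set0 ->
  exists! a, A a /\ forall b, A b -> omega1_le a b.
Proof.
move=> [a0 Aa0].
have wo : wochoice.well_order set_nat_le := svalP (wochoice.well_ordering_principle _).
pose P : {pred set nat} := [pred x | `[< exists2 a, A a & sval a = x >]].
have [|m [[/asboolP[a Aa am] mlb] muniq]] := wo P.
  by exists (sval a0); apply/asboolP; exists a0.
have amin b : A b -> omega1_le a b.
  move=> Ab; rewrite /omega1_le am; apply: mlb.
  by apply/asboolP; exists b.
exists a; split=> [|b [Ab blb]]; first by split.
apply: val_inj => /=; rewrite am; apply: muniq; split.
  by apply/asboolP; exists b.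
by move=> x /asboolP[c Ac <-]; apply: blb.
Qed.

Lemma omega1_uncountable : ~ countable [set: omega1].
Proof.
move=> c1.
have wo : wochoice.well_order set_nat_le := svalP (wochoice.well_ordering_principle _).
have [tot anti] : total set_nat_le /\ antisymmetric set_nat_le.
  have chT : wochoice.wo_chain set_nat_le predT by apply: wochoice.withinW.
  split=> x y.
    exact: (wochoice.wo_chainW chT).
  exact: (wochoice.wo_chain_antisymmetric chT).
pose S := [set x | countable [set y | set_nat_le y x]].
have cS : countable S.
  have -> : S = (fun a : omega1 => sval a) @` setT.
    rewrite eqEsubset; split=> [x Sx|x [a _ <-]]; first by exists (exist _ x Sx).
    exact: (svalP a).
  exact: sub_countable (card_image_le _ _) c1.
have [/asboolP-[x nSx]|nex] := boolP `[< exists x, ~ S x >]; last first.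
  have /countable_injP[f /in2TT finj] : countable [set: set nat].
    by apply: sub_countable cS; apply: subset_card_le => x _;
       apply: contrapT => nSx; move/asboolP: nex; apply; exists x.
  pose D := [set n | exists2 A, f A = n & ~ A n].
  have DfD : ~ D (f D) by move=> h; case: (h) => A /finj -> /(_ h).
  by apply: (DfD); exists D.
pose P : {pred set nat} := [pred x | `[< ~ S x >]].
have [|m [[/asboolP nSm mlb] _]] := wo P; first by exists x; apply/asboolP.
apply: nSm; rewrite /S /=.
have sub : [set y | set_nat_le y m] `<=` S `|` [set m].
  move=> y /= ym; have [Sy|nSy] := pselect (S y); [by left|right].
  by apply: anti; rewrite ym mlb//; apply/asboolP.
apply: sub_countable (subset_card_le sub) _.
have -> : S `|` [set m] = \bigcup_(b in [set: bool]) (if b then S else [set m]).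
  rewrite eqEsubset; split=> [z [Sz|zm]|z [[] _]]; [by exists true|by exists false|by left|by right].
by apply: bigcup_countable => // -[] _ //; exact: finite_set_countable.
Qed.

Lemma omega1_countable_segment (a : omega1) :
  countable [set b | omega1_le b a].
Proof.
have /countable_injP[f finj] := svalP a.
apply/countable_injP; exists (f \o sval) => b c.
rewrite !inE => ba ca /finj bc; apply: val_inj; apply: bc; rewrite inE.
  exact: ba.
exact: ca.
Qed.

Definition monotonically_omega1_resolvable (X : topologicalType) : Prop :=
  exists f : X -> omega1,
    forall a : omega1, dense [set x | omega1_le a (f x)].

(* [is_Delta X K] states that Delta(X), the minimum of the cardinalities of the
   nonempty open subsets of X, exists and is the cardinality of K. *)
Definition is_Delta (X : topologicalType) (K : Type) : Prop :=
  (exists G : set X, [/\ open G, G !=set0 & G #= [set: K]]) /\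
  (forall G : set X, open G -> G !=set0 -> [set: K] #<= G).

(* Main.v *)
Require Import Defs.
From mathcomp Require Import all_boot.
From mathcomp Require Import boolp classical_sets functions cardinality filter.
From mathcomp Require Import topology_structure.
From HB Require Import structures.

Local Open Scope classical_set_scope.
Local Open Scope card_scope.

(** Topologize [K] by declaring the members of a nonprincipal complete
ultrafilter [U], together with the empty set, to be open: members of [U] have
full cardinality, and the dense sets are exactly the members of [U].  A
resolving map [f : K -> omega1] would push [U] forward to a countably complete
ultrafilter containing every final segment.  Since [omega1] is a set of subsets
of [nat], deciding the membership of each [n] pins this pushforward down to a
single point [a], which contradicts that some element of [omega1] is not below
[a]. *)

Definition ultra_space (K : Type) (U : set_system K) (hU : UltraFilter U) :
  Type := K.

Section UltraSpace.
Variables (K : Type) (U : set_system K) (hU : UltraFilter U).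

Definition ultra_open : set_system (ultra_space K U hU) :=
  [set A | A = set0 \/ U A].

Lemma ultra_openT : ultra_open setT.
Proof. by right; exact: filterT. Qed.

Lemma ultra_openI : setI_closed ultra_open.
Proof.
move=> A B [->|UA] [->|UB]; rewrite ?set0I ?setI0; [by left|by left|by left|].
by right; exact: filterI.
Qed.

Lemma ultra_open_bigcup (I : Type) (f : I -> set (ultra_space K U hU)) :
  (forall i, ultra_open (f i)) -> ultra_open (\bigcup_i f i).
Proof.
move=> fop; have [[i Ufi]|nU] := pselect (exists i, U (f i)).
  by right; apply: filterS Ufi => x fix_; exists i.
left; rewrite -subset0 => x [i _]; have [->//|Ufi] := fop i.
by case: nU; exists i.
Qed.

HB.instance Definition _ := Choice.copy (ultra_space K U hU) {classic K}.
HB.instance Definition _ := isOpenTopological.Build (ultra_space K U hU)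
  ultra_openT ultra_openI ultra_open_bigcup.

Lemma ultra_space_openE (A : set (ultra_space K U hU)) :
  open A = (A = set0 \/ U A).
Proof. by []. Qed.

Lemma ultra_space_dense (D : set (ultra_space K U hU)) : dense D -> U D.
Proof.
move=> dD; have [//|UnD] := in_ultra_setVsetC D hU.
have [||x [nDx Dx]] := dD (~` D); [exact: filter_ex UnD|by right|].
by have := nDx Dx.
Qed.

End UltraSpace.

Section CompleteUltrafilter.
Variables (K : Type) (U : set_system K) (hU : UltraFilter U).
Hypothesis Ucomplete : card_complete U.

(** If [A] were smaller than [K], the complements of its points would be fewer than [K] members of
    [U], with an intersection disjoint from [A]. *)
Lemma card_complete_large (A : set K) :
  (forall x, U <> principal_filter x) -> U A -> [set: K] #<= A.
Proof.
move=> Unp UA; apply: contrapT => KA.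
have UC x : U (~` [set x]).
  have [Ux|//] := in_ultra_setVsetC [set x] hU.
  (* With [[set x]] in [U], every member of [U] contains [x], so maximality makes [U] principal at
     [x]. *)
  case: (Unp x); apply: esym; apply: max_filter.
    exact: principal_filter_proper.
  move=> B UB; apply/principal_filterP.
  by have [y [By <-]] := filter_ex (filterI UB Ux).
pose F := (fun x => ~` [set x]) @` A.
have FA : F #<= A by exact: card_image_le.
have UF : U (\bigcap_(B in F) B).
  apply: Ucomplete; last by move=> _ [x _ <-].
  split; first exact: card_le_trans FA (card_leT A).
  by move=> KF; apply: KA; exact: card_le_trans KF FA.
have [x [Ax Fx]] := filter_ex (filterI UA UF).
by apply: (Fx (~` [set x])) => //; exists x.
Qed.

Hypothesis Kuncountable : ~ countable [set: K].

Lemma card_complete_countable (F : nat -> set K) :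
  (forall n, U (F n)) -> U (\bigcap_n F n).
Proof.
move=> UF; have cF : countable (range F).
  exact: sub_countable (card_image_le F setT) _.
have -> : \bigcap_n F n = \bigcap_(A in range F) A by rewrite bigcap_image.
apply: Ucomplete; last by move=> _ [n _ <-].
split; last by move=> KF; apply: Kuncountable; exact: sub_countable KF cF.
(* An uncountable [K] is infinite, so [nat] embeds in it. *)
apply: card_le_trans cF _; apply/infiniteP => fK.
exact: Kuncountable (finite_set_countable fK).
Qed.

(** [U] decides each question [f x n], and countable completeness lets all the decisions, collected
    in [A], hold at once on a member of [U]. *)
Lemma card_complete_set_nat_constant (f : K -> set nat) :
  exists A, U (f @^-1` [set A]).
Proof.
pose A : set nat := [set n | U [set x | f x n]].
exists A; pose F n := [set x | f x n <-> A n].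
have UF n : U (F n).
  have [UA|UA] := in_ultra_setVsetC [set x | f x n] hU.
    by apply: filterS (UA) => x fxn; split.
  apply: filterS (UA) => x nfxn; split=> // An.
  by have [y []] := filter_ex (filterI An UA).
apply: filterS (card_complete_countable F UF) => x Fx.
by apply/seteqP; split=> n; apply Fx.
Qed.

Lemma card_complete_not_cofinal (f : K -> omega1) :
  ~ forall a, U [set x | omega1_le a (f x)].
Proof.
move=> Uf; have [A UA] := card_complete_set_nat_constant (sval \o f).
have [y /= fyA] := filter_ex UA.
(* Each [b] lies below some [f x] with the same value [A] as [f y], so the countable segment below
   [f y] is all of [omega1]. *)
apply: omega1_uncountable; apply: sub_countable (omega1_countable_segment (f y)).
apply: subset_card_le => b _ /=.
have [x [/= fxA]] := filter_ex (filterI UA (Uf b)).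
by rewrite /omega1_le fyA fxA.
Qed.

End CompleteUltrafilter.

Theorem theorem1p4 (K : Type) (hK : measurable_cardinal K) :
  exists X : topologicalType,
    [/\ [set: X] #= [set: K], is_Delta X K
      & ~ monotonically_omega1_resolvable X].
Proof.
have [Kunc [U [hU Unp Uc]]] := hK.
exists (ultra_space K U hU); split; first exact: card_eqxx.
  split; first by exists setT; split; [exact: openT|exact: filter_ex (@filterT _ U _)|exact: card_eqxx].
  move=> G; rewrite ultra_space_openE => -[->[]//|UG _].
  exact: card_complete_large.
move=> [f df]; apply: (card_complete_not_cofinal K U hU Uc Kunc f) => a.
exact: ultra_space_dense (df a).
Qed.
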